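(* Let $A_n$ be a self-adjoint operator in a Hilbert space $\mathcal H_n$ for each $n\in\overline{\mathbb N}$ such that $(A_n)_{n\in\mathbb N}$ QUE-converges to $A_\infty$ at $z_0$ with identification operators $(J_n)_{n\in\mathbb N}$ and convergence speed $(\delta_n)_n$. Suppose furthermore that a parent space $\mathcal H$ with isometries $\iota_n:\mathcal H_n\to\mathcal H$ ($n\in\overline{\mathbb N}$) factorising $(J_n)_{n\in\mathbb N}$ exists and that the projections $P_n=\iota_n\iota_n^*$ and $P_\infty=\iota_\infty\iota_\infty^*$ commute, i.e. $P_nP_\infty=P_\infty P_n$ for all $n\in\mathbb N$. Then $(A_n)_{n\in\mathbb N}$ Weidmann-converges to $A_\infty$ at $z_0$ with convergence speed $(3\delta_n)_n$.
   Context: All Hilbert spaces are complex and separable; $\mathbb N=\{1,2,\dots\}$, $\overline{\mathbb N}=\mathbb N\cup\{\infty\}$; norms of operators are operator norms; $\rho(A)$ is the resolvent set. For $z_0\in\bigcap_{n\in\overline{\mathbb N}}\rho(A_n)$ write $R_n:=(A_n-z_0)^{-1}$, $n\in\overline{\mathbb N}$. Let $(\delta_n)_{n\in\mathbb N}$ be a sequence in $[0,\infty)$ with $\delta_n\to0$. $(A_n)_{n\in\mathbb N}$ Weidmann-converges to $A_\infty$ at $z_0$ with convergence speed $(\delta_n)_n$ if there exist a Hilbert space $\mathcal H$ and isometries $\iota_n:\mathcal H_n\to\mathcal H$ ($n\in\overline{\mathbb N}$) such that $\|\iota_nR_n\iota_n^*-\iota_\infty R_\infty\iota_\infty^*\|\le\delta_n$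 for all $n\in\mathbb N$. $(A_n)_{n\in\mathbb N}$ QUE-converges to $A_\infty$ at $z_0$ with identification operators $(J_n)_n$ and convergence speed $(\delta_n)_n$ if $J_n:\mathcal H_n\to\mathcal H_\infty$ ($n\in\mathbb N$) are bounded operators such that for all $n\in\mathbb N$: (i) $\|J_n\|\le1+\delta_n$; (ii) $\|(\mathrm{id}_{\mathcal H_n}-J_n^*J_n)R_n\|\le\delta_n$ and $\|(\mathrm{id}_{\mathcal H_\infty}-J_nJ_n^* )R_\infty\|\le\delta_n$; (iii) $\|R_\infty J_n-J_nR_n\|\le\delta_n$; and, if $z_0\in\mathbb C\setminus\mathbb R$, (ii) and (iii) also hold with $R_n,R_\infty$ replaced by $R_n^*,R_\infty^*$. A parent space for $(\mathcal H_n)_{n\in\overline{\mathbb N}}$ is a Hilbert space $\mathcal H$ together with isometries $\iota_n:\mathcal H_n\to\mathcal H$ for all $n\in\overline{\mathbb N}$; these isometries factorise $(J_n)_{n\in\mathbb N}$ if $J_n=\iota_\infty^*\iota_n$ for all $n\in\mathbb N$. *)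

(* Defs.v *)
From HB Require Import structures.
From mathcomp Require Import all_boot all_order all_algebra.
From mathcomp Require Import sesquilinear complex.
From mathcomp Require Import all_classical all_reals all_analysis.

Set Implicit Arguments.
Unset Strict Implicit.
Unset Printing Implicit Defensive.

Import Order.TTheory GRing.Theory Num.Theory.
Import numFieldNormedType.Exports.

Local Open Scope classical_set_scope.
Local Open Scope ring_scope.

(** Separable complex Hilbert spaces.  The norm of a [normedModType R[i]] takes
    values in [R[i]]; [inner] is linear in its first argument. *)
Record hilbertType (R : realType) := Hilbert {
  hilbert_sort :> completeNormedModType R[i];
  inner : {dot hilbert_sort for Num.conj};
  innerE : forall x : hilbert_sort, inner x x = `|x| ^+ 2;
  hilbert_separable :
    exists2 S : set hilbert_sort, countable S & dense S
}.

(** Extended-real valued, so that an unbounded operator has norm [+oo]. *)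
Definition opnorm (R : realType) (V W : hilbertType R) (T : V -> W) : \bar R :=
  ereal_sup [set (complex.Re `|T x|)%:E | x in [set x : V | `|x| <= 1]].

Definition opnorm_le (R : realType) (V W : hilbertType R) (T : V -> W) (d : R) :
    Prop :=
  (opnorm T <= d%:E)%E.

Definition bounded_op (R : realType) (V W : hilbertType R) (T : V -> W) : Prop :=
  (opnorm T < +oo)%E.

Definition isometric (R : realType) (V W : hilbertType R) (T : V -> W) : Prop :=
  forall x : V, `|T x| = `|x|.

(** The adjoint of a bounded linear operator: by the Riesz representation
    theorem the set below is then a singleton for every [y]. *)
Definition adj (R : realType) (V W : hilbertType R) (T : V -> W) : W -> V :=
  fun y => xget 0 [set z : V | forall x : V, inner W (T x) y = inner V x z].

(** Linear operators in [V], not necessarily everywhere defined: only the values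
    of [act] on the subspace [dom] are meaningful. *)
Record operator (R : realType) (V : hilbertType R) := Operator {
  dom : set V;
  act :> V -> V;
  dom0 : dom 0;
  dom_linear : forall (a : R[i]) (u v : V), dom u -> dom v -> dom (a *: u + v);
  act_linear : forall (a : R[i]) (u v : V), dom u -> dom v ->
    act (a *: u + v) = a *: act u + act v
}.

Definition graph (R : realType) (V : hilbertType R) (A : operator V) :
    set (V * V) :=
  [set p | dom A p.1 /\ A p.1 = p.2].

(** For a densely defined [A], the graph of its adjoint operator. *)
Definition adj_graph (R : realType) (V : hilbertType R) (A : operator V) :
    set (V * V) :=
  [set p | forall x : V, dom A x -> inner V (A x) p.1 = inner V x p.2].

Definition self_adjoint (R : realType) (V : hilbertType R) (A : operator V) :
    Prop :=
  dense (dom A) /\ graph A = adj_graph A.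

(** [(A - z)^-1], meaningful for [z] in the resolvent set of [A]. *)
Definition resolvent (R : realType) (V : hilbertType R) (A : operator V)
    (z : R[i]) : V -> V :=
  fun y => xget 0 [set x : V | dom A x /\ A x - z *: x = y].

Definition resolvent_set (R : realType) (V : hilbertType R) (A : operator V) :
    set R[i] :=
  [set z | (forall y : V, exists! x : V, dom A x /\ A x - z *: x = y) /\
           bounded_op (resolvent A z)].

(** The natural numbers extended by infinity. *)
Inductive Nbar := Fin of nat | Infty.
Coercion Fin : nat >-> Nbar.

Definition convergence_speed (R : realType) (delta : nat -> R) : Prop :=
  (forall n, 0 <= delta n) /\ delta @ \oo --> (0 : R).

Definition parent_space (R : realType) (H : Nbar -> hilbertType R)
    (K : hilbertType R) (iota : forall n : Nbar, {linear H n -> K}) : Prop :=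
  forall n : Nbar, isometric (iota n).

Definition factorise (R : realType) (H : Nbar -> hilbertType R)
    (K : hilbertType R) (iota : forall n : Nbar, {linear H n -> K})
    (J : forall n : nat, {linear H n -> H Infty}) : Prop :=
  forall n : nat, J n =1 adj (iota Infty) \o iota n.

Definition Weidmann_converges (R : realType) (H : Nbar -> hilbertType R)
    (A : forall n : Nbar, operator (H n)) (z0 : R[i]) (delta : nat -> R) :
    Prop :=
  let Rz (n : Nbar) : H n -> H n := resolvent (A n) z0 in
  [/\ forall n : Nbar, resolvent_set (A n) z0,
      convergence_speed delta &
      exists (K : hilbertType R) (iota : forall n : Nbar, {linear H n -> K}),
        parent_space iota /\
        forall n : nat,
          opnorm_le ((iota n \o Rz n \o adj (iota n)) \-
                     (iota Infty \o Rz Infty \o adj (iota Infty))) (delta n)].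

(** Conditions (ii) and (iii) of QUE-convergence at the index [n], for bounded
    operators [Rn], [Roo] (the resolvents or their adjoints). *)
Definition QUE_bounds (R : realType) (V W : hilbertType R)
    (J : V -> W) (Rn : V -> V) (Roo : W -> W) (d : R) : Prop :=
  [/\ opnorm_le ((idfun \- (adj J \o J)) \o Rn) d,
      opnorm_le ((idfun \- (J \o adj J)) \o Roo) d &
      opnorm_le ((Roo \o J) \- (J \o Rn)) d].

Definition QUE_converges (R : realType) (H : Nbar -> hilbertType R)
    (A : forall n : Nbar, operator (H n)) (z0 : R[i])
    (J : forall n : nat, {linear H n -> H Infty}) (delta : nat -> R) : Prop :=
  let Rz (n : Nbar) : H n -> H n := resolvent (A n) z0 in
  [/\ forall n : Nbar, resolvent_set (A n) z0,
      convergence_speed delta,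
      forall n : nat, bounded_op (J n) &
      forall n : nat,
        [/\ opnorm_le (J n) (1 + delta n),
            QUE_bounds (J n) (Rz n) (Rz Infty) (delta n) &
            complex.Im z0 != 0 ->
            QUE_bounds (J n) (adj (Rz n)) (adj (Rz Infty)) (delta n)]].

(* Main.v *)
(* Write i, j for the isometries of indices n, oo into the parent space, i', j'
   for their adjoints, P = i i', Q = j j', and S, T for the resolvents of indices
   n, oo; then J = j' i.  With w = i' y,
     i S i' y - j T j' y
       = (1 - Q) i S w - j (T J - J S) w - j T j' (1 - P) y.
   The middle term is bounded by (iii).  As P and Q commute,
   (1 - Q) i = i (1 - J' J), so (ii) bounds the first term; likewise
   (1 - P) j = j (1 - J J'), so the last term is bounded by passing to the
   adjoint and using (ii) for the adjoint of T, which is T when z0 is real. *)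
Require Import Defs.
From HB Require Import structures.
From mathcomp Require Import all_boot all_order all_algebra.
From mathcomp Require Import sesquilinear complex ring lra.
From mathcomp Require Import all_classical all_reals all_analysis.

Import Order.TTheory GRing.Theory Num.Theory.
Import numFieldNormedType.Exports.

Local Open Scope classical_set_scope.
Local Open Scope ring_scope.
Local Open Scope complex_scope.

(** * The underlying real inner product space, Cauchy-Schwarz and Riesz representation *)

Lemma Re_realM (R : realType) (t : R) (c : R[i]) :
  complex.Re (t%:C * c) = t * complex.Re c.
Proof. by case: c => a b; simpc. Qed.

Section RealStructure.
Context {R : realType} {V : hilbertType R}.
Implicit Types (x y z : V) (t : R).

(** Norms in [V] take values in [R[i]]; passing to [R] gives a total order and makes [nra] and [lra]
    applicable. *)
Definition nrm x : R := complex.Re `|x|.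

Definition rinner x y : R := complex.Re (inner V x y).

Lemma nrmE x : `|x| = (nrm x)%:C.
Proof. by rewrite /nrm RRe_real// normr_real. Qed.

Lemma nrm_ge0 x : 0 <= nrm x.
Proof. by rewrite -lecR -nrmE normr_ge0. Qed.

Lemma nrm0 : nrm 0 = 0.
Proof. by rewrite /nrm normr0. Qed.

Lemma nrm_eq0 x : nrm x = 0 -> x = 0.
Proof. by move=> x0; apply: normr0_eq0; rewrite nrmE x0. Qed.

Lemma nrmZ t x : nrm (t%:C *: x) = `|t| * nrm x.
Proof.
rewrite /nrm normrZ nrmE; have -> : `|t%:C| = `|t|%:C.
  by rewrite normc_def /= expr0n addr0 sqrtr_sqr.
by rewrite -rmorphM.
Qed.

Lemma nrmD x y : nrm (x + y) <= nrm x + nrm y.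
Proof. by rewrite -lecR rmorphD /= -!nrmE ler_normD. Qed.

Lemma nrmN x : nrm (- x) = nrm x.
Proof. by rewrite /nrm normrN. Qed.

Lemma innerC x y : inner V x y = (inner V y x)^*.
Proof. by rewrite (hermC (inner V) x y) expr0 mul1r. Qed.

Lemma innerPl a x y z : inner V (a *: x + y) z = a * inner V x z + inner V y z.
Proof. by rewrite linearPl. Qed.

Lemma innerPr a x y z :
  inner V x (a *: y + z) = a^* * inner V x y + inner V x z.
Proof.
by rewrite innerC innerPl rmorphD rmorphM (innerC x y) (innerC x z).
Qed.

Lemma innerBl x y z : inner V (x - y) z = inner V x z - inner V y z.
Proof. by rewrite linearBl. Qed.

Lemma innerBr x y z : inner V x (y - z) = inner V x y - inner V x z.
Proof. by rewrite linearBr. Qed.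

Lemma rinnerC x y : rinner x y = rinner y x.
Proof. by rewrite /rinner innerC; case: (inner V y x). Qed.

Lemma rinnerDl x y z : rinner (x + y) z = rinner x z + rinner y z.
Proof. by rewrite /rinner linearDl raddfD. Qed.

Lemma rinnerZl t x y : rinner (t%:C *: x) y = t * rinner x y.
Proof. by rewrite /rinner linearZl_LR Re_realM. Qed.

Lemma rinnerxx x : rinner x x = nrm x ^+ 2.
Proof. by rewrite /rinner innerE nrmE -rmorphXn. Qed.

Lemma nrmDZ_sq t x y :
  nrm (x + t%:C *: y) ^+ 2 = nrm x ^+ 2 + 2 * t * rinner x y + t ^+ 2 * nrm y ^+ 2.
Proof.
rewrite -!rinnerxx rinnerDl rinnerZl !(rinnerC _ (_ + _)) !rinnerDl !rinnerZl.
by rewrite (rinnerC y x); ring.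
Qed.

Lemma rinner_le x y : rinner x y <= nrm x * nrm y.
Proof.
have [y0|yn0] := eqVneq (nrm y) 0.
  by rewrite (nrm_eq0 _ y0) nrm0 mulr0 /rinner linear0r.
have yp : 0 < nrm y by rewrite lt_def yn0 nrm_ge0.
(* The product is the squared distance from [x] to the real line spanned by [y], attained at the
   coefficient used below. *)
have : 0 <= (nrm x - rinner x y / nrm y) * (nrm x + rinner x y / nrm y).
  have := sqr_ge0 (nrm (x + (- (rinner x y / nrm y ^+ 2))%:C *: y)).
  rewrite nrmDZ_sq; congr (_ <= _); field.
  by [].
have x0 := nrm_ge0 x.
have [rn|rp] := leP (rinner x y) 0.
  by move=> _; apply: (le_trans rn); rewrite mulr_ge0 // ltW.
rewrite pmulr_lge0 ?subr_ge0 ?ler_pdivrMr//.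
by rewrite ltr_wpDl// divr_gt0.
Qed.

Lemma inner_injr y z : (forall x, inner V x y = inner V x z) -> y = z.
Proof.
move=> h; apply/eqP; rewrite -subr_eq0; apply/eqP/nrm_eq0; apply/eqP.
by rewrite -sqrf_eq0 -rinnerxx /rinner innerBr h subrr.
Qed.

End RealStructure.

(* The representing vector minimises [|x|^2 - 2 Re f x]: by the parallelogram
   identity minimising sequences are Cauchy. *)
Lemma riesz (R : realType) (V : hilbertType R) (f : V -> R[i]) (M : R) :
  scalar f -> (forall x, complex.Re (f x) <= M * nrm x) ->
  exists z, forall x, f x = inner V x z.
Proof.
move=> fL fM.
have f0 : f 0 = 0 by have := fL (-1) 0 0; rewrite scaler0 addr0 mulN1r addNr.
have fZ a x : f (a *: x) = a * f x by have := fL a x 0; rewrite !addr0 f0 addr0.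
pose g x := complex.Re (f x).
have gDZ (t : R) x y : g (x + t%:C *: y) = g x + t * g y.
  by rewrite /g addrC fL raddfD /= Re_realM addrC.
pose phi (x : V) := nrm x ^+ 2 - 2 * g x.
pose m := inf (range phi).
have phi_ge x : m <= phi x.
  apply: ge_inf; last by exists x.
  (* Completing the square: [phi y] is at least (|y| - M)^2 - M^2. *)
  exists (- M ^+ 2) => _ [y _ <-]; rewrite /phi.
  have := fM y; have := sqr_ge0 (nrm y - M); rewrite -/(g y); nra.
have phi_mid x y : nrm (x + (-1)%:C *: y) ^+ 2 <= 2 * (phi x + phi y - 2 * m).
  (* The argument is the midpoint of [x] and [y]; the parallelogram identity gives |x - y|^2 = 2
     (phi x + phi y - 2 phi mid). *)
  have := phi_ge (x + ((-(1/2))%:C) *: (x + (-1)%:C *: y)).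
  set d := x + (-1)%:C *: y.
  have -> : phi y = phi (x + (-1)%:C *: d).
    congr phi; rewrite /d scalerDr scalerA -rmorphM mulrNN mul1r scale1r.
    by rewrite rmorphN rmorph1 scaleN1r addrA subrr add0r.
  rewrite /phi !nrmDZ_sq !gDZ; nra.
have phi_near (e : R) : 0 < e -> exists x, phi x < m + e.
  move=> e0; have [|_ [x _ <-] h] := @inf_adherent _ (range phi) e e0.
  - split; first by exists (phi 0), 0.
    by exists m => _ [y _ <-].
  - by exists x.
(* The filter of sublevel sets of [phi] near its infimum replaces a chosen minimising sequence. *)
pose F : set_system V := filter_from [set e : R | 0 < e]
  (fun e => [set x | phi x < m + e]).
have FF : ProperFilter F.
  apply: filter_from_proper; last by move=> e /phi_near.
  apply: filter_from_filter; first by exists 1; rewrite /= ltr01.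
  move=> i j i0 j0; exists (Num.min i j); first by rewrite /= lt_min i0.
  move=> x /= h; split => /=; apply: (lt_le_trans h); rewrite lerD2l.
    by rewrite ge_min lexx.
  by rewrite ge_min lexx orbT.
have Fball (e : R) : 0 < e -> exists2 x, phi x < m + e ^+2 / 4 &
    F (ball x (e%:C)).
  (* With [phi x] and [phi y] both below m + e^2/4, [phi_mid] gives |x - y|^2 < e^2. *)
  move=> e0; have ee : 0 < e ^+ 2 / 4 by rewrite divr_gt0 ?exprn_gt0.
  have [x xm] := phi_near _ ee; exists x => //; exists (e ^+ 2 / 4) => //= y /= ym.
  rewrite -ball_normE /= nrmE ltcR -(@ltr_pXn2r _ 2) ?nnegrE ?nrm_ge0 ?ltW//.
  have := phi_mid x y; rewrite rmorphN rmorph1 scaleN1r; lra.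
have cF : cvg F.
  apply: cauchy_cvg; apply: cauchy_exP => e e0.
  have [e' ee] : exists e', e = e'%:C.
    by exists (complex.Re e); rewrite RRe_real ?gtr0_real.
  by rewrite ee ltcR in e0; have [x _] := Fball _ e0; exists x; rewrite ee.
pose z := lim F.
have phiz_le (e : R) : 0 < e -> phi z <= m + e.
  move=> e0.
  (* Expanding [phi] around [z] gives phi z <= phi x + 2 c |z - x|. The bound e/(4c) on |z - x|
     makes the error at most e/2; the summand 1 keeps [c] positive. *)
  pose c := nrm z + `|M| + 1.
  have c0 : 0 < c by rewrite ltr_wpDl// addr_ge0// nrm_ge0.
  pose d := Num.min 1 (e / (4 * c)).
  have d0 : 0 < d by rewrite lt_min ltr01 divr_gt0// mulr_gt0.
  have : F (ball z d%:C) by apply: cF; apply: nbhsx_ballx; rewrite ltcR.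
  move=> [a /= a0 aball].
  have [x xm] : exists x, phi x < m + Num.min a (e / 4).
    by apply: phi_near; rewrite lt_min a0 divr_gt0.
  have : ball z d%:C x.
    apply: aball => /=; apply: (lt_le_trans xm); rewrite lerD2l.
    by rewrite ge_min lexx.
  rewrite -ball_normE /= nrmE ltcR => zx.
  have {}xm : phi x < m + e / 4.
    by apply: (lt_le_trans xm); rewrite lerD2l ge_min lexx orbT.
  have phix : phi x = phi (z + (-1)%:C *: (z - x)).
    by rewrite rmorphN rmorph1 scaleN1r subKr.
  have gu : - g (z - x) <= `|M| * nrm (z - x).
    have := fM ((-1)%:C *: (z - x)); rewrite -/(g _) nrmZ normrN1 mul1r.
    have := gDZ (-1) 0 (z - x); rewrite add0r mulN1r => ->.
    rewrite /g f0 sub0r => /le_trans; apply.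
    by rewrite ler_wpM2r ?nrm_ge0 ?ler_norm.
  have zu := rinner_le z (z - x).
  have cu : c * nrm (z - x) <= e / 4.
    apply: (@le_trans _ _ (c * (e / (4 * c)))).
      by rewrite ler_pM2l// (le_trans (ltW zx))// ge_min lexx orbT.
    by rewrite le_eqVlt; apply/orP; left; apply/eqP; field; rewrite gt_eqF.
  have := nrm_ge0 (z - x); have := sqr_ge0 (nrm (z - x)).
  move: cu xm; rewrite phix /c /phi nrmDZ_sq gDZ; nra.
have phiz x : phi z <= phi x.
  by apply: (le_trans _ (phi_ge x)); apply/ler_addgt0Pr.
exists z.
have gz x : g x = rinner x z.
  pose k := rinner z x - g x; pose n := nrm x ^+ 2.
  have n0 : 0 <= n by apply: sqr_ge0.
  have : 0 <= - (k ^+ 2 * (n + 2)).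
    (* First-order optimality with an explicit step: for t = -k/(n + 1), phi (z + t x) - phi z = 2 t
       k + t^2 n = -k^2 (n + 2)/(n + 1)^2. The denominator n + 1 stays nonzero even at [x] = 0. *)
    have := phiz (z + (- (k / (n + 1)))%:C *: x).
    rewrite /phi nrmDZ_sq gDZ -/n -subr_ge0 -(@pmulr_rge0 _ ((n + 1) ^+ 2)).
      by congr (_ <= _); rewrite /k; field; rewrite gt_eqF// ltr_wpDl.
    by rewrite exprn_gt0// ltr_wpDl.
  rewrite oppr_ge0 pmulr_lle0 ?ltr_wpDl// => k2.
  have /eqP : k ^+ 2 == 0 by rewrite eq_le k2 sqr_ge0.
  by move=> /eqP; rewrite sqrf_eq0 subr_eq0 rinnerC => /eqP.
(* Real parts agree everywhere; evaluating also at i x recovers the imaginary parts. *)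
move=> x; have := gz x; have := gz ('i%C *: x); rewrite /g /rinner fZ.
rewrite linearZl_LR /=; case: (f x) => a b; case: (inner V x z) => a' b'.
by rewrite !(mulrC 'i%C) !ReiNIm /= => /oppr_inj -> ->.
Qed.

(** * Operator norm bounds and adjoints of bounded operators *)

Section BoundedOperators.
Context {R : realType} {V W : hilbertType R}.
Implicit Types (T : V -> W) (d : R).

Lemma linear_op0 T : linear T -> T 0 = 0.
Proof. by move=> Tl; have := Tl (-1) 0 0; rewrite scaler0 addr0 scaleN1r addNr. Qed.

Lemma linear_opZ T : linear T -> scalable T.
Proof. by move=> Tl a x; have := Tl a x 0; rewrite linear_op0// !addr0. Qed.

Lemma linear_opB T : linear T -> {morph T : x y / x - y}.
Proof.
move=> Tl x y; have := Tl (-1) y x; rewrite !scaleN1r => e.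
by rewrite addrC e addrC.
Qed.

Lemma linear_opN T : linear T -> {morph T : x / - x}.
Proof. by move=> Tl x; rewrite -sub0r linear_opB// linear_op0// sub0r. Qed.

Lemma opnorm_le_bound T d : scalable T -> opnorm_le T d ->
  forall x, nrm (T x) <= d * nrm x.
Proof.
move=> TZ Td x; have [x0|xn0] := eqVneq (nrm x) 0.
  have -> : x = 0%:C *: 0 by rewrite scaler0; apply: nrm_eq0.
  by rewrite TZ !nrmZ normr0 !mul0r mulr0.
have xp : 0 < nrm x by rewrite lt_def xn0 nrm_ge0.
have nrmV : `|(nrm x)^-1| = (nrm x)^-1 by rewrite ger0_norm ?invr_ge0 ?nrm_ge0.
have h : ((nrm (T ((nrm x)^-1%:C *: x)))%:E <= opnorm T)%E.
  apply: ereal_sup_ubound; exists ((nrm x)^-1%:C *: x) => //=.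
  by rewrite nrmE -[1]/(1%:C) lecR nrmZ nrmV mulVf.
have := le_trans h Td.
by rewrite lee_fin TZ nrmZ nrmV mulrC ler_pdivrMr.
Qed.

Lemma bound_opnorm_le T d : 0 <= d -> (forall x, nrm (T x) <= d * nrm x) ->
  opnorm_le T d.
Proof.
move=> d0 Td; apply: ge_ereal_sup => _ [x /= x1 <-].
rewrite lee_fin (le_trans (Td x))// ler_piMr//.
by rewrite -lecR -nrmE.
Qed.

Lemma bounded_op_bound T : scalable T -> bounded_op T ->
  exists M, forall x, nrm (T x) <= M * nrm x.
Proof.
move=> TZ Tb; exists (fine (opnorm T)); apply: opnorm_le_bound => //.
rewrite /opnorm_le fineK// fin_numE -ltey Tb andbT gt_eqF//.
(* The value at the zero vector keeps the supremum away from -oo, so [fine] is faithful. *)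
apply: (lt_le_trans (ltNyr 0)); apply: ereal_sup_ubound.
exists 0; first by rewrite /= normr0.
have -> : T 0 = 0 by rewrite -(scale0r 0) TZ scale0r.
by rewrite normr0.
Qed.

Lemma adj_unique T y z :
  (forall x, inner W (T x) y = inner V x z) -> adj T y = z.
Proof.
move=> h; apply: inner_injr => x; rewrite -h /adj.
by case: xgetP => [u _ ->|/(_ z)].
Qed.

(** By Cauchy-Schwarz the functional x |-> <T x, y> is bounded by M |y|, so [riesz] provides a
    witness and [adj] does not fall back on its default 0. *)
Lemma adjP T M : linear T -> (forall x, nrm (T x) <= M * nrm x) ->
  forall x y, inner W (T x) y = inner V x (adj T y).
Proof.
move=> Tl TM x y.
have [z hz] : exists z, forall x, inner W (T x) y = inner V x z.
  apply: (@riesz _ _ _ (M * nrm y)).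
    by move=> a u v; rewrite Tl innerPl.
  move=> u; apply: (le_trans (rinner_le _ _)).
  by rewrite mulrAC ler_wpM2r ?nrm_ge0.
by rewrite hz (adj_unique _ _ _ hz).
Qed.

Lemma linear_adj T M : linear T -> (forall x, nrm (T x) <= M * nrm x) ->
  linear (adj T).
Proof.
move=> Tl TM a u v; apply: adj_unique => x.
by rewrite !innerPr !(adjP _ _ Tl TM).
Qed.

End BoundedOperators.

(** * Isometries and their adjoints *)

Section Isometry.
Context {R : realType} {V K : hilbertType R} (i : {linear V -> K}).
Hypothesis iI : isometric i.

Lemma nrm_isometric x : nrm (i x) = nrm x.
Proof. by rewrite /nrm iI. Qed.

Lemma isometric_bound x : nrm (i x) <= 1 * nrm x.
Proof. by rewrite nrm_isometric mul1r. Qed.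

Lemma adj_isometricP x y : inner K (i x) y = inner V x (adj i y).
Proof. exact: (adjP _ _ (linearP i) isometric_bound). Qed.

Lemma linear_adj_isometric : linear (adj i).
Proof. exact: (linear_adj _ _ (linearP i) isometric_bound). Qed.

Lemma adj_isometricPr y x : inner V (adj i y) x = inner K y (i x).
Proof. by rewrite innerC -adj_isometricP -innerC. Qed.

(** From |i' y|^2 = <i i' y, y> <= |i i' y| |y| = |i' y| |y|. *)
Lemma nrm_adj_isometric y : nrm (adj i y) <= nrm y.
Proof.
have [->|/eqP h] := eqVneq (nrm (adj i y)) 0; first exact: nrm_ge0.
have h0 : 0 < nrm (adj i y) by rewrite lt_def nrm_ge0 andbT; apply/eqP.
rewrite -(ler_pM2l h0) -expr2 -rinnerxx /rinner -adj_isometricP.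
by rewrite -[X in _ <= X * _]nrm_isometric rinner_le.
Qed.

(** No polarisation: with x' = i' i x, <x, x'> = |i x|^2 = |x|^2 and |x'| <= |x|, hence |x - x'|^2 =
    |x'|^2 - |x|^2 <= 0. *)
Lemma adj_isometricK x : adj i (i x) = x.
Proof.
have := nrm_adj_isometric (i x); rewrite nrm_isometric; set x' := adj i (i x).
have xx' : rinner x x' = nrm x ^+ 2.
  by rewrite /rinner -adj_isometricP innerE iI -innerE -/(rinner x x) rinnerxx.
move=> x'x; have : nrm (x + (-1)%:C *: x') ^+ 2 <= 0.
  rewrite nrmDZ_sq xx'; have := nrm_ge0 x'; nra.
rewrite rmorphN rmorph1 scaleN1r => le0.
have /eqP : nrm (x - x') ^+ 2 == 0 by rewrite eq_le le0 sqr_ge0.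
by move=> /eqP; rewrite sqrf_eq0 => /eqP/nrm_eq0/eqP; rewrite subr_eq0 => /eqP.
Qed.

End Isometry.

(** * Resolvents: linearity, boundedness, symmetry at real points *)

Section Resolvent.
Context {R : realType} {V : hilbertType R} (A : operator V) (z : R[i]).
Hypothesis Az : resolvent_set A z.

Lemma resolventP y :
  dom A (resolvent A z y) /\ A (resolvent A z y) - z *: resolvent A z y = y.
Proof.
have [x [hx _]] := Az.1 y; rewrite /resolvent.
by case: xgetP => [u _ //|/(_ x)].
Qed.

Lemma resolvent_unique x y : dom A x -> A x - z *: x = y -> resolvent A z y = x.
Proof.
move=> Dx e; have [u [_ hu]] := Az.1 y.
by rewrite -(hu x)// (hu _ (resolventP y)).
Qed.

Lemma linear_resolvent : linear (resolvent A z).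
Proof.
move=> a u v; have [Du eu] := resolventP u; have [Dv ev] := resolventP v.
apply: resolvent_unique; first exact: dom_linear.
rewrite act_linear// -[in RHS]eu -[in RHS]ev scalerBr scalerDr !scalerA.
by rewrite (mulrC z) opprD addrACA.
Qed.

Lemma resolvent_bound : exists M, forall x, nrm (resolvent A z x) <= M * nrm x.
Proof. exact: (bounded_op_bound _ (linear_opZ _ linear_resolvent) Az.2). Qed.

(** Covers real [z0], where QUE-convergence gives no separate bounds for adjoints. Writing x = (A -
    z) u and y = (A - z) v reduces the claim to the symmetry of [A]. *)
Lemma resolvent_symmetric : self_adjoint A -> complex.Im z = 0 ->
  forall x y, inner V (resolvent A z x) y = inner V x (resolvent A z y).
Proof.
move=> [_ Asa] z0 x y.
have [Du eu] := resolventP x; have [Dv ev] := resolventP y.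
rewrite -[in LHS]ev -[in RHS]eu; set u := resolvent _ _ x; set v := resolvent _ _ y.
have : adj_graph A (v, A v) by rewrite -Asa.
move=> /(_ u Du) /= Auv; rewrite innerBr innerBl Auv; congr (_ - _).
rewrite linearZl_LR -[z *: v]addr0 innerPr linear0r addr0; congr (_ * _).
by case: z z0 => a b /= ->; rewrite -[LHS]/(a -i* 0) oppr0.
Qed.

End Resolvent.

(** * The estimate for commuting projections *)

Section CommutingProjections.
Context {R : realType} {V W K : hilbertType R}.
Context (i : {linear V -> K}) (j : {linear W -> K}) (J : V -> W).
Hypotheses (iI : isometric i) (jI : isometric j) (Jij : J =1 adj j \o i).
Hypothesis PQ : (i \o adj i) \o (j \o adj j) =1 (j \o adj j) \o (i \o adj i).

Lemma adj_factorised y : adj J y = adj i (j y).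
Proof.
apply: adj_unique => x.
by rewrite Jij /= innerC -adj_isometricP// -innerC adj_isometricP.
Qed.

(** Since P fixes the range of [i], commutation gives P Q i x = Q P i x = Q i x: the vector Q i x
    lies in the range of [i]. *)
Lemma defect_left x : i (x - adj J (J x)) = i x - j (adj j (i x)).
Proof.
rewrite linearB adj_factorised Jij /=; have := PQ (i x).
by rewrite /= adj_isometricK// => ->.
Qed.

Lemma defect_right y : j (y - J (adj J y)) = j y - i (adj i (j y)).
Proof.
rewrite linearB adj_factorised Jij /=; have := PQ (j y).
by rewrite /= adj_isometricK// => <-.
Qed.

Variables (A : V -> V) (B B' : W -> W) (d : R).
Hypothesis d0 : 0 <= d.
Hypotheses (Bl : linear B) (BB' : forall x y, inner W (B x) y = inner W x (B' y)).
Hypothesis A_defect : forall x, nrm (A x - adj J (J (A x))) <= d * nrm x.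
Hypothesis B_defect : forall y, nrm (B' y - J (adj J (B' y))) <= d * nrm y.
Hypothesis intertwine : forall x, nrm (B (J x) - J (A x)) <= d * nrm x.

(** By duality: for w = B j' (1 - P) y, moving every factor across the inner product gives |w|^2 =
    Re <y, (1 - P) j B' w>. By [defect_right] this is Re <y, j (1 - J J') B' w> <= |y| d |w|; then
    cancel |w|. *)
Lemma right_defect_bound y :
  nrm (B (adj j (y - i (adj i y)))) <= d * nrm y.
Proof.
set w := B _; have [->|wn0] := eqVneq (nrm w) 0.
  by rewrite mulr_ge0 ?nrm_ge0.
have w0 : 0 < nrm w by rewrite lt_def wn0 nrm_ge0.
rewrite -(ler_pM2l w0) -expr2 -rinnerxx.
have -> : rinner w w = rinner y (j (B' w - J (adj J (B' w)))).
  rewrite {1}/w /rinner BB' defect_right.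
  by rewrite adj_isometricPr// innerBl innerBr adj_isometricP// adj_isometricPr.
apply: (le_trans (rinner_le _ _)); rewrite nrm_isometric//.
by rewrite mulrC mulrA ler_wpM2r ?nrm_ge0// mulrC B_defect.
Qed.

Lemma commuting_projections_bound y :
  nrm (i (A (adj i y)) - j (B (adj j y))) <= 3 * d * nrm y.
Proof.
set w := adj i y.
(* Insert j J A w and j B J w, where J w = j' i w. In the last term i w - y = -(1 - P) y, which is
   the form treated by [right_defect_bound] up to sign. *)
have -> : i (A w) - j (B (adj j y)) = i (A w - adj J (J (A w)))
    - j (B (J w) - J (A w)) + j (B (adj j (i w - y))).
  rewrite defect_left linearB (linear_opB _ (linear_adj_isometric _ jI)).
  rewrite (linear_opB _ Bl) linearB !Jij /=.
  by rewrite opprK (addrC (- _)) addrA subrK linearB addrA subrK.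
have dw : d * nrm w <= d * nrm y by rewrite ler_wpM2l// nrm_adj_isometric.
have t1 : nrm (i (A w - adj J (J (A w)))) <= d * nrm y.
  by rewrite nrm_isometric// (le_trans (A_defect _)).
have t2 : nrm (- j (B (J w) - J (A w))) <= d * nrm y.
  by rewrite nrmN nrm_isometric// (le_trans (intertwine _)).
have t3 : nrm (j (B (adj j (i w - y)))) <= d * nrm y.
  rewrite nrm_isometric// -(opprB y (i w)) (linear_opN _ (linear_adj_isometric _ jI)).
  by rewrite (linear_opN _ Bl) nrmN right_defect_bound.
have -> : 3 * d * nrm y = d * nrm y + d * nrm y + d * nrm y by ring.
by do 2!(apply: (le_trans (nrmD _ _)); apply: lerD => //).
Qed.


End CommutingProjections.

(** * Assembly in the given parent space *)

Theorem theorem2p14 (R : realType) (H : Nbar -> hilbertType R)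
    (A : forall n : Nbar, operator (H n)) (z0 : R[i]) (delta : nat -> R)
    (J : forall n : nat, {linear H n -> H Infty})
    (K : hilbertType R) (iota : forall n : Nbar, {linear H n -> K}) :
  (forall n : Nbar, self_adjoint (A n)) ->
  QUE_converges A z0 J delta ->
  parent_space iota ->
  factorise iota J ->
  (let P (n : Nbar) : K -> K := iota n \o adj (iota n) in
   forall n : nat, P n \o P Infty =1 P Infty \o P n) ->
  Weidmann_converges A z0 (fun n => 3 * delta n).
Proof.
move=> Asa [Az [delta0 delta_cvg] Jb QUE] iI Jij PQ; split=> //.
  split; first by move=> n; rewrite mulr_ge0.
  by rewrite -(mulr0 3); apply: cvgM => //; apply: cvg_cst.
exists K, iota; split=> // n; apply: bound_opnorm_le; first by rewrite mulr_ge0.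
have [_ [An_defect Aoo_defect intertwine] adj_bounds] := QUE n.
have Rl m := linear_resolvent (A m) z0 (Az m).
have [M RM] := resolvent_bound (A Infty) z0 (Az Infty).
have Jadj := adj_factorised _ _ _ (iI n) (iI Infty) (Jij n).
have adjJl : linear (adj (J n)).
  move=> a u v; rewrite !Jadj linearP.
  exact: linear_adj_isometric.
have defect_left_bound (T : H n -> H n) : linear T ->
    opnorm_le ((idfun \- (adj (J n) \o J n)) \o T) (delta n) ->
    forall x, nrm (T x - adj (J n) (J n (T x))) <= delta n * nrm x.
  move=> Tl; apply: opnorm_le_bound => a x /=.
  by rewrite linear_opZ// linearZ (linear_opZ _ adjJl) scalerBr.
have defect_right_bound (T : H Infty -> H Infty) : linear T ->
    opnorm_le ((idfun \- (J n \o adj (J n))) \o T) (delta n) ->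
    forall y, nrm (T y - J n (adj (J n) (T y))) <= delta n * nrm y.
  move=> Tl; apply: opnorm_le_bound => a x /=.
  by rewrite linear_opZ// (linear_opZ _ adjJl) linearZ scalerBr.
(* [B'] unifies the two cases: the resolvent itself for real [z0], its adjoint otherwise, each with
   the matching form of condition (ii). *)
have [B' B'l [BB' B'_defect]] : exists2 B' : H Infty -> H Infty, linear B' &
    (forall x y, inner _ (resolvent (A Infty) z0 x) y = inner _ x (B' y)) /\
    opnorm_le ((idfun \- (J n \o adj (J n))) \o B') (delta n).
  have [z0R|z0NR] := eqVneq (complex.Im z0) 0.
    exists (resolvent (A Infty) z0); first exact: Rl.
    by split=> //; apply: resolvent_symmetric.
  have [_ adj_defect _] := adj_bounds z0NR.
  exists (adj (resolvent (A Infty) z0)); first exact: linear_adj (Rl _) RM.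
  by split=> //; apply: adjP RM.
apply: (commuting_projections_bound _ _ (J n) (iI n) (iI Infty) (Jij n) (PQ n)
  _ _ B') => //.
- exact: defect_left_bound.
- exact: defect_right_bound.
- apply: opnorm_le_bound intertwine => a x /=.
  by rewrite linearZ (linear_opZ _ (Rl _)) (linear_opZ _ (Rl _)) linearZ scalerBr.
Qed.
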